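(* Let $n\geq 3$, let $\mathcal K\subseteq\mathbb R^n$ be a proper subdual cone and $\mathcal C=\mathbb S^{n-1}\cap\operatorname{int}(\mathcal K)$. Let $A=A^\top\in\mathbb R^{n\times n}$ and let $\{v^1,\dots,v^n\}$ be an orthonormal system of eigenvectors of $A$ corresponding to the eigenvalues $\lambda_1,\dots,\lambda_n$, respectively, such that $v^1\in\operatorname{int}(\mathcal K^* )$. Let $$\alpha:=\min\{\langle v^1,y\rangle^2:\ y\in\mathbb S^{n-1}\cap\mathcal K\}>0,\qquad \eta:=\max\left\{\frac{\langle v^3,y\rangle^2+\dots+\langle v^n,y\rangle^2}{\langle v^1,y\rangle^2}:\ y\in\mathbb S^{n-1}\cap\mathcal K\right\}>0.$$ Assume that $$\lambda_1<\lambda_2\leq\dots\leq\lambda_n\leq\lambda_2+\delta(\lambda_2-\lambda_1),\qquad\text{where }\delta\in\{\alpha,1/\eta\}.$$ Then $\lambda_2 I_n-A$ is $\mathcal K$-copositive. Consequently, the quadratic function $q_A:\mathcal C\to\mathbb R$, $q_A(x)=\langle Ax,x\rangle$, is spherically quasi-convex.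
   Context: $\langle\cdot,\cdot\rangle$ and $\|\cdot\|$ are the canonical inner product and norm of $\mathbb R^n$; $I_n$ is the identity matrix; $\mathbb S^{n-1}=\{x\in\mathbb R^n:\|x\|=1\}$. A cone is a set $\mathcal K\subseteq\mathbb R^n$ with $\alpha x\in\mathcal K$ for all $\alpha>0$, $x\in\mathcal K$. Its dual is $\mathcal K^*=\{x\in\mathbb R^n:\langle x,y\rangle\ge 0\ \forall y\in\mathcal K\}$. A cone is pointed if $\mathcal K\cap(-\mathcal K)\subseteq\{0\}$; proper if it is a pointed closed convex cone with nonempty interior; subdual if $\mathcal K\subseteq\mathcal K^*$. A matrix $M\in\mathbb R^{n\times n}$ is $\mathcal K$-copositive if $\langle Mx,x\rangle\ge 0$ for all $x\in\mathcal K$. The intrinsic distance on the sphere is $d(x,y)=\arccos\langle x,y\rangle$; a geodesic is the intersection of the sphere with a plane through the origin, and a geodesic segment joining $x$ to $y$ is minimal if its length is $d(x,y)$. A set $\mathcal C\subseteq\mathbb S^{n-1}$ is spherically convex if it contains all minimal geodesic segments joining any two of its points (the set $\mathcal C=\mathbb S^{n-1}\cap\operatorname{int}(\mathcal K)$ is spherically convex). A function $f:\mathcal C\to\mathbb R$ on a spherically convex set is spherically quasi-convex if for every minimal geodesic segment $\gamma:I\to\mathcal C$ ($I\subseteq\mathbb R$ an interval), $f(\gamma(t))\le\max\{f(\gamma(t_1)),f(\gamma(t_2))\}$ for all $t\in[t_1,t_2]\subseteq I$. *)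

(* Defs.v *)
From mathcomp Require Import all_boot all_order all_algebra.
From mathcomp Require Import all_classical all_reals all_analysis.

Set Implicit Arguments.
Unset Strict Implicit.
Unset Printing Implicit Defensive.

Import Order.TTheory GRing.Theory Num.Theory.
Import numFieldNormedType.Exports.

Local Open Scope classical_set_scope.
Local Open Scope ring_scope.

Section Cones.
Context {R : realType} {n : nat}.
Implicit Types (x y : 'cV[R]_n) (K : set 'cV[R]_n) (M : 'M[R]_n).

Definition dot x y : R := \sum_(i < n) x i 0 * y i 0.

(* The library's norm on matrices is the sup norm, hence this one; the topology
   on ['cV[R]_n], used below for closedness and interiors, is the usual one. *)
Definition enorm x : R := Num.sqrt (dot x x).

Definition usphere : set 'cV[R]_n := [set x | enorm x = 1].

Definition cone K := forall (a : R) x, 0 < a -> K x -> K (a *: x).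

Definition dual_cone K : set 'cV[R]_n := [set x | forall y, K y -> 0 <= dot x y].

Definition pointed K := K `&` [set x | K (- x)] `<=` [set 0].

Definition proper_cone K :=
  [/\ cone K, pointed K, closed K,
      convex_set (K : set (convex_lmodType 'cV[R]_n)) & interior K !=set0].

Definition subdual K := K `<=` dual_cone K.

Definition qform M x : R := dot (M *m x) x.

Definition copositive K M := forall x, K x -> 0 <= qform M x.

End Cones.

Section Sphere.
Context {R : realType} {n : nat}.
Implicit Types (x y : 'cV[R]_n) (C : set 'cV[R]_n) (g : R -> 'cV[R]_n).

Definition sdist x y : R := acos (dot x y).

(* The plane is the column space of [P]. *)
Definition geodesic (G : set 'cV[R]_n) :=
  exists2 P : 'M[R]_(n, 2), \rank P = 2%N &
    G = usphere `&` [set x | exists c : 'cV[R]_2, x = P *m c].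

(* Length of a curve in the metric space (sphere, [sdist]): the supremum, over
   all subdivisions a = t_0 < ... < t_k = b, of the sums of the distances of
   consecutive points. *)
Definition arc_length (a b : R) g : \bar R :=
  ereal_sup [set (\sum_(0 <= k < size s)
                   sdist (g (nth b (a :: s) k)) (g (nth b (a :: s) k.+1)))%:E
            | s in [set s | itv_partition a b s]].

(* Parametrizations are only required to be continuous, not of constant
   speed. *)
Definition minimal_geodesic_segment (a b : R) g :=
  [/\ a <= b, {within `[a, b], continuous g},
      (exists2 G, geodesic G & forall t, t \in `[a, b] -> G (g t)) &
      arc_length a b g = (sdist (g a) (g b))%:E].

Definition spherically_convex C :=
  C `<=` usphere /\
  forall (a b : R) g, minimal_geodesic_segment a b g ->
    C (g a) -> C (g b) -> forall t, t \in `[a, b] -> C (g t).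

(* Spherical convexity of the domain is part of the notion; only the values of
   [f] on [C] matter.  A curve on an arbitrary interval [I] is a minimal
   geodesic segment when its restriction to each [a, b] included in [I] is. *)
Definition spherically_quasiconvex C (f : 'cV[R]_n -> R) :=
  spherically_convex C /\
  forall (I : set R) g, is_interval I ->
    (forall a b, I a -> I b -> a <= b -> minimal_geodesic_segment a b g) ->
    (forall t, I t -> C (g t)) ->
    forall t1 t2 t, I t1 -> I t2 -> t1 <= t <= t2 ->
      f (g t) <= Num.max (f (g t1)) (f (g t2)).

End Sphere.

Definition is_min {R : realType} (E : set R) (m : R) := E m /\ lbound E m.
Definition is_max {R : realType} (E : set R) (m : R) := E m /\ ubound E m.

(* Main.v *)
Require Import Defs.
From mathcomp Require Import all_boot all_order all_algebra.
From mathcomp Require Import all_classical all_reals all_analysis.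
From mathcomp Require Import ring lra.

Set Implicit Arguments.
Unset Strict Implicit.
Unset Printing Implicit Defensive.

Import Order.TTheory GRing.Theory Num.Theory.
Import numFieldNormedType.Exports.

Local Open Scope classical_set_scope.
Local Open Scope ring_scope.

(** Write [c_i] for the coordinate [dot (v i) y] of a unit vector [y] of [K], the
    first two having indices 0 and 1, and [tail] for the sum of the [c_i ^+ 2]
    with [2 <= i].  In the eigenbasis ([parseval],
    [qform_scalar_sub_eigenbasis]) the form of [(lambda 1)%:M - A] at [y] is the
    sum of the [(lambda 1 - lambda i) * c_i ^+ 2].  Its only positive
    contribution is [gap * c_0 ^+ 2], with [gap = lambda 1 - lambda 0], and the
    terms with [2 <= i] lose at most [delta * gap * tail].  It is thus
    enough that [delta * tail <= c_0 ^+ 2], which holds for [delta = alpha]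
    because [tail <= 1] and [alpha <= c_0 ^+ 2], and for [delta = 1 / eta] by
    definition of [eta].  Both extrema are attained, since the sphere meets [K]
    in a compact set ([compact_usphereI]) and [c_0] is positive there
    ([interior_dual_gt0]); [eta] is positive because [K], having interior points,
    contains a unit vector that is not orthogonal to [v 2] ([usphereI_neq0]).

    For quasiconvexity, let [x], [y] be the end points of a minimal geodesic
    segment and [z] a point on it.  Additivity of the length gives
    [sdist x z + sdist z y <= sdist x y], and the equality case of the spherical
    triangle inequality puts [z] in the plane angle spanned by [x] and [y]
    ([sdist_between_lincomb]); subduality excludes antipodal end points.  Let [c]
    be the larger of the two end values of [qform A].  If [lambda 1 <= c],
    copositivity bounds [qform A z] by [lambda 1].  Otherwise [A - c%:M] is
    nonnegative on the orthogonal complement of [v 0], hence its nonpositive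
    vectors on the side of [v 0] form a convex Lorentz cone
    ([nonpositive_halfcone_convex]), which contains [x] and [y] and so [z]. *)

(** * Inner product, unit vectors and quadratic forms *)

Section InnerProduct.
Context {R : realType} {n : nat}.
Implicit Types (x y z u w : 'cV[R]_n) (M : 'M[R]_n) (a b s t : R).

Lemma dotE x y : dot x y = (x^T *m y) 0 0.
Proof. by rewrite mxE; apply: eq_bigr => i _; rewrite mxE. Qed.

Lemma dotC x y : dot x y = dot y x.
Proof. by apply: eq_bigr => i _; rewrite mulrC. Qed.

Lemma dotDl x y z : dot (x + y) z = dot x z + dot y z.
Proof. by rewrite !dotE linearD mulmxDl mxE. Qed.

Lemma dotZl a x y : dot (a *: x) y = a * dot x y.
Proof. by rewrite !dotE linearZ -scalemxAl mxE. Qed.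

Lemma dotDr x y z : dot x (y + z) = dot x y + dot x z.
Proof. by rewrite dotC dotDl ![dot _ x]dotC. Qed.

Lemma dotZr a x y : dot x (a *: y) = a * dot x y.
Proof. by rewrite dotC dotZl [dot _ x]dotC. Qed.

Lemma dotNl x y : dot (- x) y = - dot x y.
Proof. by rewrite -scaleN1r dotZl mulN1r. Qed.

Lemma dotNr x y : dot x (- y) = - dot x y.
Proof. by rewrite dotC dotNl dotC. Qed.

Definition dot_linear := (dotDl, dotDr, dotZl, dotZr, dotNl, dotNr).

Lemma dot_ge0 x : 0 <= dot x x.
Proof. by apply: sumr_ge0 => i _; rewrite -expr2 sqr_ge0. Qed.

Lemma dot_le0_eq0 x : dot x x <= 0 -> x = 0.
Proof.
move=> x_le0; have /eqP : dot x x = 0 by apply/eqP; rewrite eq_le x_le0 dot_ge0.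
rewrite psumr_eq0 => [|i _]; last by rewrite -expr2 sqr_ge0.
move=> /allP x0; apply/colP => i; rewrite mxE; apply/eqP.
by rewrite -sqrf_eq0 expr2; exact: x0 (mem_index_enum i).
Qed.

Lemma dot_gt0 x : x != 0 -> 0 < dot x x.
Proof.
by rewrite ltNge; apply: contraNN => /dot_le0_eq0 ->.
Qed.

Lemma usphere_dot x : usphere x <-> dot x x = 1.
Proof.
rewrite /usphere /= /enorm; split => [x1|->]; last exact: sqrtr1.
by rewrite -(sqr_sqrtr (dot_ge0 x)) x1 expr1n.
Qed.

Lemma usphere_normalize x : x != 0 -> usphere ((enorm x)^-1 *: x).
Proof.
move=> /dot_gt0 x_gt0; apply/usphere_dot; rewrite dotZl dotZr mulrA -expr2.
by rewrite exprVn sqr_sqrtr ?dot_ge0 // mulVf // gt_eqF.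
Qed.

Lemma usphere_neq0 x : usphere x -> x != 0.
Proof.
move=> /usphere_dot x1; apply: contra_eq_neq x1 => ->.
by rewrite -(scale0r 0) dotZl mul0r eq_sym oner_eq0.
Qed.

(** Both bounds say that the squared norms of [x + y] and [x - y] are
    nonnegative. *)
Lemma usphere_dot_itv x y : usphere x -> usphere y -> -1 <= dot x y <= 1.
Proof.
move=> /usphere_dot xx /usphere_dot yy.
have := dot_ge0 (x - y); have := dot_ge0 (x + y).
rewrite !dot_linear xx yy (dotC y x); lra.
Qed.

Lemma dot_mulmx M x y : dot (M *m x) y = dot x (M^T *m y).
Proof. by rewrite !dotE trmx_mul mulmxA. Qed.

Lemma qform_lincomb M x y a b : M = M^T ->
  qform M (a *: x + b *: y) =
  a ^+ 2 * qform M x + 2 * (a * b * dot (M *m x) y) + b ^+ 2 * qform M y.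
Proof.
move=> symM; rewrite /qform mulmxDr -!scalemxAr !dot_linear.
have -> : dot (M *m y) x = dot (M *m x) y by rewrite dot_mulmx -symM dotC.
ring.
Qed.

Lemma qform_scalar_sub M a x : qform (a%:M - M) x = a * dot x x - qform M x.
Proof. by rewrite /qform mulmxBl mul_scalar_mx !dot_linear. Qed.

(** A form with a single negative direction, seen by [u], has as its nonpositive
    half-cone a convex (Lorentz) cone.  The combination of [x] and [y] which is
    orthogonal to [u] has a nonnegative value; expanding that value forces the
    mixed term to be nonpositive. *)
Lemma nonpositive_halfcone_convex M u x y s t : M = M^T ->
    (forall w, dot u w = 0 -> 0 <= qform M w) ->
    0 < dot u x -> 0 < dot u y -> qform M x <= 0 -> qform M y <= 0 ->
    0 <= s -> 0 <= t ->
  qform M (s *: x + t *: y) <= 0.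
Proof.
move=> symM Mge0 ux uy Mx My s0 t0.
have /Mge0 : dot u (dot u y *: x + (- dot u x) *: y) = 0.
  by rewrite !dot_linear; ring.
rewrite !(qform_lincomb _ _ _ _ symM) => mixed.
have Mxy : dot (M *m x) y <= 0.
  have uxy : 0 < dot u x * dot u y by rewrite mulr_gt0.
  rewrite -(pmulr_rle0 _ uxy).
  have : dot u y ^+ 2 * qform M x <= 0 by rewrite mulr_ge0_le0 // sqr_ge0.
  have : dot u x ^+ 2 * qform M y <= 0 by rewrite mulr_ge0_le0 // sqr_ge0.
  by move: mixed; rewrite sqrrN; lra.
have : s ^+ 2 * qform M x <= 0 by rewrite mulr_ge0_le0 // sqr_ge0.
have : t ^+ 2 * qform M y <= 0 by rewrite mulr_ge0_le0 // sqr_ge0.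
have : s * t * dot (M *m x) y <= 0 by rewrite mulr_ge0_le0 // mulr_ge0.
lra.
Qed.

End InnerProduct.

(** * The equality case of the spherical triangle inequality *)

Section Betweenness.
Context {R : realType} {n : nat}.
Implicit Types (x y z : 'cV[R]_n).

(** Equality in the spherical triangle inequality forces [z] into the planar
    angle spanned by [x] and [y].  With [a], [b] the distances from [z] to [x]
    and [y], monotonicity of the cosine bounds [dot x y] by [cos (a + b)], and
    this bound makes the squared norm of
    [sin b *: x + sin a *: y - sin (a + b) *: z] nonpositive. *)
Lemma sdist_between_lincomb x y z :
    usphere x -> usphere y -> usphere z -> -1 < dot x y ->
    sdist x z + sdist z y <= sdist x y ->
  exists s t : R, [/\ 0 <= s, 0 <= t & z = s *: x + t *: y].
Proof.
move=> Sx Sy Sz xyN1; rewrite /sdist.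
have [xz zy xy] : [/\ -1 <= dot x z <= 1, -1 <= dot z y <= 1 &
    -1 <= dot x y <= 1] by split; exact: usphere_dot_itv.
set a := acos (dot x z); set b := acos (dot z y) => ab_le.
have [a0 api] : 0 <= a /\ a <= pi by rewrite acos_ge0 ?acos_lepi.
have [b0 bpi] : 0 <= b /\ b <= pi by rewrite acos_ge0 ?acos_lepi.
have cosa : cos a = dot x z by rewrite acosK // in_itv.
have cosb : cos b = dot z y by rewrite acosK // in_itv.
have ab_pi : a + b < pi.
  by rewrite (le_lt_trans ab_le) // acos_ltpi // xyN1; case/andP: xy.
have sa0 : 0 <= sin a by rewrite sin_ge0_pi // a0.
have sb0 : 0 <= sin b by rewrite sin_ge0_pi // b0.
have [ab0|ab0] := leP (a + b) 0.
  (* The angle degenerates and [z = x]. *)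
  exists 1, 0; rewrite ler01 lexx; split => //.
  have a_eq0 : a = 0 by lra.
  rewrite scale1r scale0r addr0; apply/eqP; rewrite -subr_eq0; apply/eqP.
  apply: dot_le0_eq0; move/usphere_dot: Sx => xx; move/usphere_dot: Sz => zz.
  by rewrite !dot_linear xx zz (dotC z x) -cosa a_eq0 cos0; lra.
have sab : 0 < sin (a + b) by rewrite sin_gt0_pi // ab0.
have xy_le : dot x y <= cos a * cos b - sin a * sin b.
  rewrite -cosD leNgt; apply/negP => lt_xy.
  have : acos (dot x y) < a + b.
    rewrite -ltr_cos ?acosK ?in_itv //=; first by rewrite acos_ge0 ?acos_lepi.
    by rewrite (ltW ab0) (ltW ab_pi).
  by rewrite ltNge ab_le.
have w0 : sin b *: x + sin a *: y - sin (a + b) *: z = 0.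
  apply: dot_le0_eq0; move/usphere_dot: Sx => xx; move/usphere_dot: Sy => yy.
  move/usphere_dot: Sz => zz.
  rewrite !dot_linear xx yy zz (dotC z x) (dotC y x) (dotC y z) -cosa -cosb.
  rewrite sinD.
  have ca := cos2Dsin2 a; have cb := cos2Dsin2 b.
  have : sin a * sin b * dot x y <=
         sin a * sin b * (cos a * cos b - sin a * sin b).
    by rewrite ler_wpM2l // mulr_ge0.
  rewrite -subr_le0 => bound.
  rewrite [leLHS](_ : _ =
      2 * (sin a * sin b * dot x y -
           sin a * sin b * (cos a * cos b - sin a * sin b))
      + sin a ^+ 2 * (1 - (cos b ^+ 2 + sin b ^+ 2))
      + sin b ^+ 2 * (1 - (cos a ^+ 2 + sin a ^+ 2))); last by ring.
  by rewrite ca cb subrr !mulr0 !addr0 pmulr_rle0.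
exists (sin b / sin (a + b)), (sin a / sin (a + b)).
split; try by rewrite divr_ge0 // ltW.
have /(canRL (addrK _)) := w0; rewrite add0r opprK => wz.
rewrite ![_ / sin (a + b)]mulrC -!scalerA -scalerDr wz scalerA mulVf ?scale1r //.
by rewrite gt_eqF.
Qed.

End Betweenness.

(** * Points of a minimal geodesic segment *)

Section MinimalSegments.
Context {R : realType} {n : nat}.
Implicit Types (g : R -> 'cV[R]_n).

(** Cutting a segment at one point gives a lower bound for its length. *)
Lemma sdist_minimal_segment a b t g : minimal_geodesic_segment a b g ->
  a < t < b -> sdist (g a) (g t) + sdist (g t) (g b) <= sdist (g a) (g b).
Proof.
move=> [_ _ _ len_g] /andP[a_t t_b]; rewrite -lee_fin -len_g.
apply: ereal_sup_ubound; exists [:: t; b].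
  by split; rewrite /= ?a_t ?t_b ?eqxx.
by rewrite /= !big_nat_recl // big_geq //= addr0.
Qed.

Lemma minimal_segment_lincomb a b t g : minimal_geodesic_segment a b g ->
    a <= t <= b -> -1 < dot (g a) (g b) ->
  exists s r : R, [/\ 0 <= s, 0 <= r & g t = s *: g a + r *: g b].
Proof.
move=> seg_g /andP[a_t t_b] gab.
(* Subdivisions are strictly increasing, so end points cannot be cut points. *)
have [-> {a_t}|ta] := eqVneq t a.
  by exists 1, 0; rewrite scale1r scale0r addr0 ler01 lexx.
have [-> {t_b}|tb] := eqVneq t b.
  by exists 0, 1; rewrite scale1r scale0r add0r ler01 lexx.
have [a_b _ [G [P _ GE] G_g] _] := seg_g.
have S_g u : u \in `[a, b] -> usphere (g u).
  by move=> /G_g; rewrite GE => -[].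
apply: sdist_between_lincomb => //; try (apply: S_g; rewrite in_itv /=).
- by rewrite lexx.
- by rewrite a_b lexx.
- by rewrite a_t.
- apply: sdist_minimal_segment seg_g _.
  by rewrite !lt_neqAle eq_sym ta a_t tb t_b.
Qed.

End MinimalSegments.

(** * Interiors of convex cones and of their duals *)

Section ConvexCones.
Context {R : realType} {n : nat}.
Implicit Types (K : set 'cV[R]_n) (x y u : 'cV[R]_n).

Lemma cone_add K x y : cone K ->
  convex_set (K : set (convex_lmodType 'cV[R]_n)) -> K x -> K y -> K (x + y).
Proof.
move=> coneK convK Kx Ky.
have half_ge0 : 0 <= 2^-1 :> R by lra.
have half_le1 : 2^-1 <= 1 :> R by lra.
have := convK x y (Itv01 half_ge0 half_le1).
rewrite !inE => /(_ Kx Ky) /(coneK 2 _ (ltr0Sn _ 1)).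
rewrite [X in K X](_ : _ = x + y) // /conv /= /unstable.onem.
have -> : 1 - 2^-1 = 2^-1 :> R by lra.
by rewrite -scalerDr scalerA divff // scale1r.
Qed.

(** The map [u |-> s^-1 *: (u - t *: y)] pulls the neighborhood [K] of [x] back
    to a neighborhood of [s *: x + t *: y], which lies in [K] because [K] is
    stable by addition and scaling. *)
Lemma interior_scaleD K x y (s t : R) : cone K ->
  convex_set (K : set (convex_lmodType 'cV[R]_n)) ->
  interior K x -> K y -> 0 < s -> 0 <= t -> interior K (s *: x + t *: y).
Proof.
move=> coneK convK Kx Ky s0 t0.
pose h u := s^-1 *: (u - t *: y).
have h_cont : continuous h.
  by move=> u; exact: (cvgZl_tmp (cvgB cvg_id (cvg_cst _))).
have hz : h (s *: x + t *: y) = x.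
  by rewrite /h addrK scalerA mulVf ?gt_eqF // scale1r.
have : nbhs (s *: x + t *: y) (h @^-1` K).
  by apply: (h_cont (s *: x + t *: y) K); rewrite hz.
apply: filterS => u /(coneK s _ s0); rewrite /h scalerA divff ?gt_eqF //.
rewrite scale1r => Ku; move: t0; rewrite le_eqVlt => /predU1P[t0|t0].
  by move: Ku; rewrite -t0 scale0r subr0.
by rewrite -(subrK (t *: y) u); apply: cone_add => //; exact: coneK.
Qed.

Lemma interior_direction K x u : interior K x ->
  exists2 e : R, 0 < e & K (x + e *: u).
Proof.
move=> Kx.
have h_cont : continuous (fun e : R => x + e *: u).
  by move=> e; exact: (cvgD (cvg_cst _) (cvgZr_tmp cvg_id)).
have : nbhs (0 : R) [set e | K (x + e *: u)].
  by apply: (h_cont 0 K); rewrite scale0r addr0.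
move=> /nbhs_ballP [e /= e0 Ke]; exists (e / 2); first by rewrite divr_gt0.
apply: Ke; rewrite /ball /= sub0r normrN gtr0_norm ?divr_gt0 //.
by rewrite ltr_pdivrMr // ltr_pMr // ltr1n.
Qed.

(** Moving [u] a little in the direction [- y] keeps it in the dual cone, and
    this leaves [dot u y] a margin proportional to [dot y y]. *)
Lemma interior_dual_gt0 K u y : interior (dual_cone K) u -> K y -> y != 0 ->
  0 < dot u y.
Proof.
move=> /(@interior_direction _ _ (- y))[e e0 Ke] Ky /dot_gt0 yy.
have := Ke y Ky; rewrite !dot_linear mulrN subr_ge0; apply: lt_le_trans.
by rewrite mulr_gt0.
Qed.

(** Subduality makes [dot (g a) (g b)] nonnegative, so the end points are not
    antipodal and the points of the segment are combinations of them. *)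
Lemma spherically_convex_interior K : proper_cone K -> subdual K ->
  spherically_convex (usphere `&` interior K).
Proof.
move=> [coneK _ _ convK _] subK; split=> [x []//|a b g seg_g [Sa Ka] [Sb Kb] t].
rewrite in_itv /= => t_ab.
have gab : -1 < dot (g a) (g b).
  have := subK _ (interior_subset Ka) _ (interior_subset Kb).
  by apply: lt_le_trans; rewrite ltrN10.
have St : usphere (g t).
  by have [_ _ [G [P _ ->] Gg] _] := seg_g; case: (Gg t).
have [s [r [s0 r0 gt]]] := minimal_segment_lincomb seg_g t_ab gab.
split; first exact: St.
rewrite gt; move: s0; rewrite le_eqVlt => /predU1P[s0|s0]; last first.
  by apply: interior_scaleD => //; exact: interior_subset.
move: r0; rewrite le_eqVlt => /predU1P[r0|r0]; last first.
  rewrite addrC; apply: interior_scaleD => //; first exact: interior_subset.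
  by rewrite -s0.
by move: (usphere_neq0 St); rewrite gt -s0 -r0 !scale0r addr0 eqxx.
Qed.

End ConvexCones.

(** * Extrema on the unit vectors of a closed set *)

Section SphereCompactness.
Context {R : realType} {n : nat}.
Implicit Types (K : set 'cV[R]_n) (x y u : 'cV[R]_n).

Lemma continuous_dot u : continuous (dot u).
Proof.
apply: continuous_big => [|i _ x]; first exact: add_continuous.
exact: (cvgM (cvg_cst _) (@coord_continuous R _ _ i 0 x)).
Qed.

Lemma continuous_dot_sqr u : continuous (fun y => dot u y ^+ 2).
Proof. by move=> y; exact: (cvgM (@continuous_dot u y) (@continuous_dot u y)). Qed.

Lemma continuous_dot_self : continuous (fun x => dot x x).
Proof.
apply: continuous_big => [|i _ x]; first exact: add_continuous.
have x_i := @coord_continuous R _ _ i 0 x.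
exact: (cvgM x_i x_i).
Qed.

Lemma continuous_trmx m1 m2 : continuous (@trmx R m1 m2).
Proof.
move=> M A /nbhs_ballP [e e0 eA]; apply/nbhs_ballP; exists e => // N [_ MN].
by apply: eA; split => // i j; rewrite !mxE; exact: MN.
Qed.

(** The Heine-Borel theorem, transported from row vectors by transposition. *)
Lemma compact_usphereI K : closed K -> compact (usphere `&` K).
Proof.
move=> closedK.
pose Q : set 'rV[R]_n := trmx @^-1` (usphere `&` K).
have -> : usphere `&` K = trmx @` Q.
  apply/seteqP; split=> [x SKx|_ [x Qx <-] //].
  by exists x^T; rewrite /Q /= ?trmxK.
apply: continuous_compact; first exact/continuous_subspaceT/continuous_trmx.
have closed_sphere : closed (@usphere R n).
  rewrite (_ : usphere = (fun x : 'cV[R]_n => dot x x) @^-1` [set 1]).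
    apply: preimage_closed; last exact: closed_eq.
    by move=> x _; exact: continuous_dot_self.
  by apply/seteqP; split=> x /usphere_dot.
apply: bounded_closed_compact; last first.
  apply: preimage_closed; last exact: closedI.
  by move=> x _; exact: continuous_trmx.
exists 1; split=> [//|r r1 x [Sx _]].
rewrite /= [leLHS]/Num.norm /= mx_normrE; apply/bigmax_leP; split; first by lra.
move=> [i j] _ /=; rewrite ord1; apply: le_trans (ltW r1).
rewrite -(ler_pXn2r (n := 2)) ?nnegrE // expr1n real_normK ?num_real //.
move/usphere_dot: Sx => <-; rewrite /dot (bigD1 j) //= !mxE -expr2 lerDl.
by apply: sumr_ge0 => k _; rewrite -expr2 sqr_ge0.
Qed.

End SphereCompactness.

Section Extrema.
Context {R : realType} {n : nat}.
Context (K : set 'cV[R]_n) (f : 'cV[R]_n -> R).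
Context (closedK : closed K) (SK_neq0 : usphere `&` K !=set0).
Context (f_cont : {in usphere `&` K, continuous f}).

Lemma usphereI_min : exists2 y, (usphere `&` K) y &
  is_min [set f y | y in usphere `&` K] (f y).
Proof.
have /(compact_EVT_min SK_neq0 (compact_usphereI closedK)) :=
  continuous_in_subspaceT f_cont.
move=> [y]; rewrite inE => SKy fy_le; exists y => //; split; first by exists y.
by move=> _ [z SKz <-]; apply: fy_le; rewrite inE.
Qed.

Lemma usphereI_max : exists2 y, (usphere `&` K) y &
  is_max [set f y | y in usphere `&` K] (f y).
Proof.
have /(compact_EVT_max SK_neq0 (compact_usphereI closedK)) :=
  continuous_in_subspaceT f_cont.
move=> [y]; rewrite inE => SKy fy_ge; exists y => //; split; first by exists y.
by move=> _ [z SKz <-]; apply: fy_ge; rewrite inE.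
Qed.

End Extrema.

(** * The quadratic form in an orthonormal eigenbasis *)

Section SpectralForm.
Context {R : realType} {n : nat}.
Context (A : 'M[R]_n) (v : 'I_n -> 'cV[R]_n) (lambda : 'I_n -> R).
Context (symA : A = A^T).
Context (orthonormal_v : forall i j, dot (v i) (v j) = (i == j)%:R).
Context (eigen_v : forall i, A *m v i = lambda i *: v i).
Implicit Types (K : set 'cV[R]_n) (x y z : 'cV[R]_n).

(** The matrix [V] with rows [v i] satisfies [V *m V^T = 1%:M]; being square, it
    is orthogonal and preserves the inner product. *)
Lemma parseval x y : dot x y = \sum_i dot (v i) x * dot (v i) y.
Proof.
pose V : 'M[R]_n := \matrix_(i, j) v i j 0.
have V_mul z i : (V *m z) i 0 = dot (v i) z.
  by rewrite mxE; apply: eq_bigr => j _; rewrite mxE.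
have VVT : V *m V^T = 1%:M.
  apply/matrixP => i j; rewrite !mxE -orthonormal_v.
  by apply: eq_bigr => k _; rewrite !mxE.
transitivity (dot (V *m x) (V *m y)); last first.
  by apply: eq_bigr => i _; rewrite !V_mul.
by rewrite dot_mulmx mulmxA (mulmx1C VVT) mul1mx.
Qed.

Lemma qform_eigenbasis x : qform A x = \sum_i lambda i * dot (v i) x ^+ 2.
Proof.
rewrite /qform parseval; apply: eq_bigr => i _.
by rewrite dotC dot_mulmx -symA eigen_v dotZr (dotC x) expr2 mulrA.
Qed.

Lemma qform_scalar_sub_eigenbasis (c : R) x :
  qform (c%:M - A) x = \sum_i (c - lambda i) * dot (v i) x ^+ 2.
Proof.
rewrite qform_scalar_sub qform_eigenbasis parseval mulr_sumr -sumrB.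
by apply: eq_bigr => i _; rewrite -expr2 mulrBl.
Qed.

(** The sublevel set of [qform A] at the larger of the two endpoint values [c]
    is cut out by the form [A - c%:M].  When [c < mu], only the direction
    [v i0] can make that form negative, so the set is the trace of a convex
    Lorentz cone; when [mu <= c], copositivity makes it all of the domain. *)
Lemma qform_spherically_quasiconvex K (i0 : 'I_n) (mu : R) :
    proper_cone K -> subdual K ->
    (forall y, K y -> y != 0 -> 0 < dot (v i0) y) ->
    (forall i, i != i0 -> mu <= lambda i) ->
    copositive K (mu%:M - A) ->
  spherically_quasiconvex (usphere `&` interior K) (qform A).
Proof.
move=> properK subK v_gt0 mu_le coposK.
split=> [|I g itvI seg_g C_g t1 t2 t I1 I2 /andP[t1t tt2]].
  exact: spherically_convex_interior.
have It : I t by apply: (itvI _ _ I1 I2); rewrite t1t tt2.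
have [S1 /interior_subset K1] := C_g _ I1.
have [S2 /interior_subset K2] := C_g _ I2.
have [St /interior_subset Kt] := C_g _ It.
have g12 : -1 < dot (g t1) (g t2).
  by have := subK _ K1 _ K2; apply: lt_le_trans; rewrite ltrN10.
have t12 : t1 <= t2 by exact: le_trans tt2.
have t_12 : t1 <= t <= t2 by rewrite t1t.
have [s [r [s0 r0 gt]]] :=
  minimal_segment_lincomb (seg_g _ _ I1 I2 t12) t_12 g12.
set c := Num.max _ _.
have c1 : qform A (g t1) <= c by rewrite le_max lexx.
have c2 : qform A (g t2) <= c by rewrite le_max lexx orbT.
have qform_sub z : usphere z -> qform (c%:M - A) z = c - qform A z.
  by move=> /usphere_dot zz; rewrite qform_scalar_sub zz mulr1.
have qformN z : qform (A - c%:M) z = - qform (c%:M - A) z.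
  by rewrite /qform -opprB mulNmx dotNl.
have [mu_c|c_mu] := leP mu c.
  apply: le_trans mu_c; have := coposK _ Kt.
  by rewrite qform_scalar_sub; move/usphere_dot: St => ->; rewrite mulr1 subr_ge0.
rewrite -subr_ge0 -qform_sub // -oppr_le0 -qformN gt.
apply: (@nonpositive_halfcone_convex _ _ _ (v i0)) => //.
- by rewrite linearB /= tr_scalar_mx -symA.
- move=> w w0; rewrite qformN qform_scalar_sub_eigenbasis oppr_ge0.
  apply: sumr_le0 => i _; have [->|/mu_le mu_i] := eqVneq i i0.
    by rewrite w0 expr0n mulr0.
  by rewrite mulr_le0_ge0 ?sqr_ge0 // subr_le0 (le_trans (ltW c_mu)).
- by apply: v_gt0 => //; exact: usphere_neq0.
- by apply: v_gt0 => //; exact: usphere_neq0.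
- by rewrite qformN oppr_le0 qform_sub // subr_ge0.
- by rewrite qformN oppr_le0 qform_sub // subr_ge0.
Qed.

(** An interior point of [K] orthogonal to [v i] can be moved along [v i]
    without leaving [K]. *)
Lemma usphereI_neq0 K (i : 'I_n) : cone K -> interior K !=set0 ->
  exists2 y, (usphere `&` K) y & dot (v i) y != 0.
Proof.
move=> coneK [y0 Ky0].
have [x Kx vx] : exists2 x, K x & dot (v i) x != 0.
  have [vy0|vy0] := eqVneq (dot (v i) y0) 0; last first.
    by exists y0 => //; exact: interior_subset.
  have [e e0 Ke] := interior_direction (v i) Ky0.
  exists (y0 + e *: v i) => //.
  by rewrite !dot_linear vy0 add0r orthonormal_v eqxx mulr1 gt_eqF.
have x0 : x != 0.
  by apply: contraNneq vx => ->; rewrite -(scale0r 0) dotZr mul0r.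
have ex0 : 0 < (enorm x)^-1 by rewrite invr_gt0 sqrtr_gt0 dot_gt0.
exists ((enorm x)^-1 *: x); last by rewrite dotZr mulf_neq0 // gt_eqF.
by split; [exact: usphere_normalize|exact: coneK].
Qed.

End SpectralForm.

Lemma copositive_usphere (R : realType) n (K : set 'cV[R]_n) (M : 'M[R]_n) :
  cone K -> (forall y, (usphere `&` K) y -> 0 <= qform M y) -> copositive K M.
Proof.
move=> coneK M_ge0 x Kx; have [->|x0] := eqVneq x 0.
  by rewrite /qform mulmx0 dot_ge0.
have ex0 : 0 < (enorm x)^-1 by rewrite invr_gt0 sqrtr_gt0 dot_gt0.
have /M_ge0 : (usphere `&` K) ((enorm x)^-1 *: x).
  by split; [exact: usphere_normalize|exact: coneK].
by rewrite /qform -scalemxAr !dot_linear !pmulr_rge0.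
Qed.

(** * Copositivity and quasiconvexity under the eigenvalue bound *)

Theorem theorem4 (R : realType) (m : nat) (K : set 'cV[R]_m.+3)
    (A : 'M[R]_m.+3) (v : 'I_m.+3 -> 'cV[R]_m.+3) (lambda : 'I_m.+3 -> R)
    (properK : proper_cone K) (subdualK : subdual K)
    (symA : A = A^T)
    (orthonormal_v : forall i j, dot (v i) (v j) = (i == j)%:R)
    (eigen_v : forall i, A *m v i = lambda i *: v i)
    (v1_int : interior (dual_cone K) (v ord0)) :
  exists alpha eta : R,
    [/\ is_min [set dot (v ord0) y ^+ 2 | y in usphere `&` K] alpha,
        0 < alpha,
        is_max [set (\sum_(i < m.+3 | (2 <= i)%N) dot (v i) y ^+ 2)
                      / dot (v ord0) y ^+ 2 | y in usphere `&` K] eta &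
        0 < eta] /\
    forall delta : R, delta = alpha \/ delta = 1 / eta ->
      lambda ord0 < lambda (inord 1) ->
      (forall i j : 'I_m.+3, (1 <= i)%N -> (i <= j)%N -> lambda i <= lambda j) ->
      lambda ord_max <=
        lambda (inord 1) + delta * (lambda (inord 1) - lambda ord0) ->
      copositive K ((lambda (inord 1))%:M - A) /\
      spherically_quasiconvex (usphere `&` interior K) (qform A).
Proof.
have [coneK _ closedK _ intK] := properK.
have v_gt0 y : K y -> y != 0 -> 0 < dot (v ord0) y.
  by move=> Ky y0; exact: interior_dual_gt0 Ky y0.
have v_sqr_gt0 y : (usphere `&` K) y -> 0 < dot (v ord0) y ^+ 2.
  by move=> [Sy Ky]; rewrite exprn_gt0 // v_gt0 // usphere_neq0.
have [y2 SKy2 vy2] := usphereI_neq0 orthonormal_v (inord 2) coneK intK.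
have SK_neq0 : usphere `&` K !=set0 by exists y2.
pose tail (y : 'cV[R]_m.+3) := \sum_(i < m.+3 | (2 <= i)%N) dot (v i) y ^+ 2.
have tail_cont : continuous tail.
  apply: continuous_big => [|i _]; first exact: add_continuous.
  exact: continuous_dot_sqr.
have [ya SKya alpha_min] := usphereI_min closedK SK_neq0
  (fun y _ => @continuous_dot_sqr _ _ (v ord0) y).
have ratio_cont : {in usphere `&` K,
    continuous (fun y => tail y / dot (v ord0) y ^+ 2)}.
  move=> y; rewrite inE => /v_sqr_gt0 vy.
  exact: (cvgM (tail_cont y) (cvgV (lt0r_neq0 vy) (@continuous_dot_sqr _ _ _ y))).
have [ye SKye eta_max] := usphereI_max closedK SK_neq0 ratio_cont.
set alpha := dot (v ord0) ya ^+ 2 in alpha_min.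
set eta := tail ye / _ in eta_max.
have eta_gt0 : 0 < eta.
  apply: lt_le_trans (eta_max.2 _ (imageP _ SKy2)).
  rewrite divr_gt0 ?v_sqr_gt0 // /tail (bigD1 (inord 2)) ?inordK //=.
  by rewrite ltr_wpDr ?exprn_even_gt0 //; apply: sumr_ge0 => i _; exact: sqr_ge0.
exists alpha, eta; split; first by split => //; exact: v_sqr_gt0.
move=> delta delta_eq lt01 lambda_mono lambda_max_le.
have tail_le y : (usphere `&` K) y -> delta * tail y <= dot (v ord0) y ^+ 2.
  move=> SKy; case: delta_eq => ->; last first.
    rewrite mul1r ler_pdivrMl // -ler_pdivrMr ?v_sqr_gt0 //.
    exact: (eta_max.2 _ (imageP _ SKy)).
  apply: le_trans (alpha_min.2 _ (imageP _ SKy)).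
  rewrite ler_piMr ?(ltW (v_sqr_gt0 _ _)) //.
  have [/usphere_dot <- _] := SKy; rewrite (parseval orthonormal_v).
  rewrite /tail big_mkcond /=; apply: ler_sum => i _.
  by rewrite -expr2; case: ifP => // _; exact: sqr_ge0.
have copos : copositive K ((lambda (inord 1))%:M - A).
  apply: copositive_usphere => // y /tail_le tail_y.
  rewrite (qform_scalar_sub_eigenbasis symA orthonormal_v eigen_v).
  set gap := lambda (inord 1) - lambda ord0 in lambda_max_le *.
  have gap_gt0 : 0 < gap by rewrite subr_gt0.
  apply: (@le_trans _ _ (gap * (dot (v ord0) y ^+ 2 - delta * tail y))).
    by rewrite mulr_ge0 ?(ltW gap_gt0) // subr_ge0.
  (* The term of index 1 vanishes, and those of larger index lose at most
     [delta * gap] times the corresponding term of [tail y]. *)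
  rewrite (bigD1 ord0) //= mulrBr lerD2l mulrA mulr_sumr -sumrN.
  rewrite [leRHS](bigID (fun i : 'I_m.+3 => (2 <= i)%N)) /= ler_wpDr //.
    apply: sumr_ge0 => i /andP[i0]; rewrite -ltnNge ltnS => i1.
    rewrite [i](_ : _ = inord 1) ?subrr ?mul0r //.
    apply: val_inj; rewrite /= inordK //; apply/eqP.
    by rewrite eqn_leq i1 lt0n.
  rewrite [leRHS](eq_bigl (fun i : 'I_m.+3 => (2 <= i)%N)); last first.
    by move=> i; rewrite andbC; case: leqP => // i2; rewrite -val_eqE /= -lt0n ltnW.
  apply: ler_sum => i i2; rewrite -mulNr ler_wpM2r ?sqr_ge0 //.
  have : lambda i <= lambda ord_max.
    by apply: lambda_mono; [exact: ltnW|exact: leq_ord].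
  by move: lambda_max_le; rewrite mulrC; lra.
split => //; apply: (qform_spherically_quasiconvex symA orthonormal_v eigen_v
  properK subdualK v_gt0 _ copos) => i i0.
by apply: lambda_mono; rewrite inordK // lt0n.
Qed.
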